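(* Let $\phi$ be a 3-SAT formula and let $M$ be the MAPF instance constructed from $\phi$ as described in the context (three-row grid with variable gadgets and clause gadgets). Then $M$ has a collision-free monotone motion plan with a distance cost of $d^*(M)$ if and only if $\phi$ is satisfiable.
   Context: A 3-SAT formula is a Boolean formula in conjunctive normal form with three literals in each clause. **MAPF.** A MAPF instance $(G,R,\{s(r),t(r)\}_{r\in R})$ consists of an undirected graph $G=(V,E)$, a set $R$ of agents, and for each $r\in R$ a start vertex $s(r)$ and a target vertex $t(r)$. A trajectory for $r$ is a map $\pi_r:\mathbb N\to V$ ($\mathbb N$ = non-negative integers, time steps) such that $\pi_r(0)=s(r)$; there is $T\in\mathbb N$ with $\pi_r(\tau)=t(r)$ for all $\tau\ge T$; and for all $\tau>0$, $\pi_r(\tau-1)=\pi_r(\tau)$ or $(\pi_r(\tau-1),\pi_r(\tau))\in E$. A motion plan is a family $\{\pi_r\}_{r\in R}$ of trajectories. It is collision-free if for all $r\ne r'$: $\pi_r(\tau)\ne\pi_{r'}(\tau)$ for all $\tau\ge0$, and $(\pi_r(\tau-1),\pi_r(\tau))\ne(\pi_{r'}(\tau),\pi_{r'}(\tau-1))$ for all $\tau>0$. The active interval of $r$ is $I_r=[\min\{\tau:\pi_r(\tau+1)\ne s(r)\},\max\{\tau:\pi_r(\tau-1)\ne t(r)\}]$, the interval from the first time $r$ leaves $s(r)$ to the last time $r$ reaches $t(r)$. A motion plan is monotone if the active intervals are pairwise disjoint, i.e., the agents move one by one. The path of $r$ is $\pi_r$ with consecutive repetitions of a vertex replaced by one occurrence;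 its length is its number of edges. The distance cost of a motion plan is the sum of the lengths of the agents' paths. $d^*(M)=\sum_{r\in R}d(s(r),t(r))$, where $d(u,v)$ is the length of a shortest path between $u$ and $v$ in $G$. **The instance $M$.** $G$ is a grid graph with three rows (top, middle, bottom): its vertices are the unit cells of a three-row grid that are not obstacles, and side-sharing cells are adjacent. Obstacles make entrances, exits and other passages one row/column wide. From left to right, $G$ consists of a room, one variable gadget for each variable of $\phi$, and one clause gadget for each clause of $\phi$. The order of gadgets of the same type, and of positions within a gadget, is arbitrary. The agents are: one literal agent for each appearance of a literal in $\phi$, and one clause agent for each clause. - *Room.* A rectangular room at the far left contains the start cells of all clause agents. There is an order in which the clause agents can leave it one by one along shortest paths without collisions. - *Variable gadgets.* They are placed in series, joined by one-cell-wide passages, and must all be traversed by the clause agents. Each has an entrance cell on the left and an exit cell on the right, and can be traversed from entrance to exit only along two paths, both shortest and both $x$-monotone: the top path (going right along the grid's top row, then down) and the bottom path. The two paths overlap near the entrance and the exit and are otherwise separate. In the gadget of variable $\alpha$, the start cells of the literal agents for appearances of $\alpha$ lie on the top path, and those for appearances of $\overline\alpha$ lie on the bottom path, off the overlap. No other agents start in the gadget (it may contain further empty cells on these paths). - *Clause gadgets.* The middle row of the gadget of clause $C$ contains the target cells of the three literal agents of the appearances of literals in $C$, and its top row contains the target cell of the clause agent of $C$. An agent heading to a clause gadget passes the preceding clause gadgets along the bottom row. A shortest path to a literal target goes right along the bottom row to the cell directly below the target and then up. A shortest path of the clause agent of $C$ to its target goes right along the bottom row and must pass up through one of the three literal targets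 of the gadget, and through each of these three there is such a shortest path. At the right of each clause gadget is an empty column, through which the clause agent's target can be reached, by a longer path, even if all three literal targets are occupied. *)

(* Defs.v *)
From HB Require Import structures.
From mathcomp Require Import all_boot.
From mathcomp Require Import perm.

Set Implicit Arguments.
Unset Strict Implicit.
Unset Printing Implicit Defensive.

(* A literal is a variable with a sign ([true] = positive).  The same literal
   may occur several times in a clause or in a formula; an appearance is a pair
   (clause index, position in the clause). *)
Definition literal (n : nat) := ('I_n * bool)%type.
Definition formula3 (n m : nat) := m.-tuple (3.-tuple (literal n)).

Definition lit_at n m (phi : formula3 n m) (i : 'I_m) (j : 'I_3) : literal n :=
  tnth (tnth phi i) j.

Definition satisfiable n m (phi : formula3 n m) : Prop :=
  exists a : 'I_n -> bool,
    forall i : 'I_m, exists j : 'I_3,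
      a (lit_at phi i j).1 = (lit_at phi i j).2.

Section Walks.
Variables (T : finType) (e : rel T).

(* As in [path], a walk from [u] is given by the list of its vertices after
   [u], so that its length is the size of the list. *)
Definition walk (u v : T) (p : seq T) : bool := path e u p && (last u p == v).

(* Equal to [#|T|] if [v] is not reachable from [u]. *)
Definition dist (u v : T) : nat :=
  find (fun k => [exists p : k.-tuple T, walk u v p]) (iota 0 #|T|).

Definition shortest_path (u v : T) (p : seq T) : bool :=
  walk u v p && (size p == dist u v).
End Walks.

Record mapf := Mapf {
  vertex : finType;
  edge : rel vertex;
  edge_sym : symmetric edge;
  agent : finType;
  start : agent -> vertex;
  target : agent -> vertex }.

Section MotionPlans.
Variable M : mapf.
Implicit Types (r : agent M) (pi : nat -> vertex M)
  (plan : agent M -> nat -> vertex M).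

Definition trajectory r pi : Prop :=
  [/\ pi 0 = start r,
      exists T, forall t, T <= t -> pi t = target r
    & forall t, pi t = pi t.+1 \/ edge (pi t) (pi t.+1)].

Definition motion_plan plan : Prop := forall r, trajectory r (plan r).

Definition collision_free plan : Prop :=
  forall r r', r <> r' ->
    (forall t, plan r t <> plan r' t) /\
    (forall t, (plan r t, plan r t.+1) <> (plan r' t.+1, plan r' t)).

Definition is_min (P : nat -> Prop) (a : nat) : Prop :=
  P a /\ forall t, P t -> a <= t.
Definition is_max (P : nat -> Prop) (b : nat) : Prop :=
  P b /\ forall t, P t -> t <= b.

(* [t] belongs to the active interval of [r]; the interval is empty for an
   agent that never moves, as the minimum and the maximum do not exist. *)
Definition active plan r (t : nat) : Prop :=
  exists a b : nat,
    [/\ is_min (fun s => plan r s.+1 <> start r) a,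
        is_max (fun s => 0 < s /\ plan r s.-1 <> target r) b
      & a <= t <= b].

Definition monotone plan : Prop :=
  forall r r', r <> r' -> forall t, ~ (active plan r t /\ active plan r' t).

(* [x :: destutter x s] is [x :: s] with consecutive repetitions merged. *)
Fixpoint destutter (V : eqType) (x : V) (s : seq V) : seq V :=
  if s is y :: s' then
    if x == y then destutter x s' else y :: destutter y s'
  else [::].

(* The path of [pi] is [pi 0 :: p]. *)
Definition path_of pi (p : seq (vertex M)) : Prop :=
  exists2 T, forall t, T <= t -> pi t = pi T
           & p = destutter (pi 0) [seq pi t.+1 | t <- iota 0 T].

Definition distance_cost plan (c : nat) : Prop :=
  exists2 p : agent M -> seq (vertex M),
    forall r, path_of (plan r) (p r) & c = \sum_(r : agent M) size (p r).

Definition dstar : nat :=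
  \sum_(r : agent M) dist (@edge M) (start r) (target r).
End MotionPlans.

(* Rows are numbered from top to bottom, columns from left to right. *)
Definition top_row : 'I_3 := @Ordinal 3 0 isT.
Definition middle_row : 'I_3 := @Ordinal 3 1 isT.
Definition bottom_row : 'I_3 := @Ordinal 3 2 isT.

Section Grid.
(* [free r c] holds if the cell in row [r], column [c] is not an obstacle; only
   columns [c < W] matter. *)
Variables (W : nat) (free : 'I_3 -> nat -> bool).

Definition cell := {c : 'I_3 * 'I_W | free c.1 c.2}.
HB.instance Definition _ := Finite.on cell.

Definition row (u : cell) : 'I_3 := (val u).1.
Definition col (u : cell) : nat := (val u).2.

Definition consecutive (a b : nat) : bool := (a.+1 == b) || (b.+1 == a).

Definition adjacent : rel cell := fun u v =>
  (row u == row v) && consecutive (col u) (col v) ||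
  (col u == col v) && consecutive (row u) (row v).

Lemma adjacent_sym : symmetric adjacent.
Proof.
by move=> u v; rewrite /adjacent /consecutive; congr (_ && _ || _ && _);
  rewrite 1?eq_sym // orbC.
Qed.

(* The top path is [entrance :: top_path] and the bottom path is
   [entrance :: bottom_path].  They share [vg_pre], [vg_post] and the end cells;
   [vg_top] and [vg_bot] are the parts off the overlap. *)
Record vgadget := VGadget {
  entrance : cell;
  vg_pre : seq cell;
  vg_top : seq cell;
  vg_bot : seq cell;
  vg_post : seq cell;
  exit : cell }.

Definition top_path (g : vgadget) : seq cell :=
  vg_pre g ++ vg_top g ++ rcons (vg_post g) (exit g).
Definition bottom_path (g : vgadget) : seq cell :=
  vg_pre g ++ vg_bot g ++ rcons (vg_post g) (exit g).

(* [g] occupies the columns [l], ..., [r - 1], and is entered in row [rl] and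
   left in row [rr]. *)
Record variable_gadget (l r : nat) (rl rr : 'I_3) (g : vgadget) : Prop := {
  vg_entrance : col (entrance g) = l /\ row (entrance g) = rl;
  vg_exit : (col (exit g)).+1 = r /\ row (exit g) = rr;
  vg_inside : all (fun u => l <= col u < r) (top_path g ++ bottom_path g);
  vg_top_shortest :
    shortest_path adjacent (entrance g) (exit g) (top_path g);
  vg_bot_shortest :
    shortest_path adjacent (entrance g) (exit g) (bottom_path g);
  vg_only : forall p, walk adjacent (entrance g) (exit g) p ->
    uniq (entrance g :: p) -> p = top_path g \/ p = bottom_path g;
  vg_top_monotone : sorted leq [seq col u | u <- entrance g :: top_path g];
  vg_bot_monotone : sorted leq [seq col u | u <- entrance g :: bottom_path g];
  vg_distinct : top_path g <> bottom_path g;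
  vg_separate : ~~ has (mem (vg_top g)) (vg_bot g);
  (* after the fork, right along the top row and then down *)
  vg_top_row : exists (a : seq cell) (c : cell) (b : seq cell),
    [/\ vg_top g ++ rcons (vg_post g) (exit g) = a ++ c :: b,
        a <> [::], all (fun u => row u == top_row) a & row c <> top_row] }.

(* [gc] occupies the columns [l], ..., [r - 1]; [s] and [tc] are the start and
   the target of its clause agent, [tl] are the targets of its literal agents.
   Since the bottom row is free, so is the top row between the literal targets
   and the clause target, and no literal target is to the right of [tc], going
   right along the bottom row, up through any of the literal targets and right
   along the top row is a shortest path to [tc]; [cg_through] says that a
   shortest path has to visit a literal target.  Column [r - 1] is the empty
   column. *)
Record clause_gadget (l r : nat) (s tc : cell) (tl : 'I_3 -> cell) : Prop := {
  cg_lit_row : forall j, row (tl j) = middle_row;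
  cg_clause_row : row tc = top_row;
  cg_columns : forall j, l <= col (tl j) <= col tc;
  cg_right : (col tc).+1 < r;
  cg_bottom : forall c, l <= c < r -> free bottom_row c;
  cg_top : forall j c, col (tl j) <= c < r -> free top_row c;
  cg_empty : forall a : 'I_3, free a r.-1;
  cg_through : forall p, shortest_path adjacent s tc p ->
    exists j, tl j \in p }.
End Grid.

(* The instances constructed from [phi].  The [W] columns are cut into
   consecutive sections: section [k] occupies columns
   [bound k], ..., [bound k.+1 - 1].  Section 0 is the room, sections 1, ..., n
   are the variable gadgets and sections n+1, ..., n+m the clause gadgets.
   Across the boundary between sections [k - 1] and [k] there is a single pair
   of adjacent free cells, in row [gate k]; longer one-cell-wide passages belong
   to the shared beginning or end of a variable gadget, or to the left part of a
   clause gadget.  The room is a rectangle without obstacles, hence the clause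
   agents can leave it in the order of their distances to its exit.
   The agent [inl (i, j)] is the literal agent of the appearance in position [j]
   of clause [i]; [inr i] is the agent of clause [i]. *)
Record construction (n m : nat) (phi : formula3 n m) := Construction {
  bound : nat -> nat;
  gate : nat -> 'I_3;
  free : 'I_3 -> nat -> bool;
  var_order : {perm 'I_n};
  clause_order : {perm 'I_m};
  var_gadget : 'I_n -> vgadget (bound (n + m).+1) free;
  start_cell : 'I_m * 'I_3 + 'I_m -> cell (bound (n + m).+1) free;
  target_cell : 'I_m * 'I_3 + 'I_m -> cell (bound (n + m).+1) free;

  bound_0 : bound 0 = 0;
  bound_lt : forall k, k <= n + m -> bound k < bound k.+1;
  gate_unique : forall k, 0 < k <= n + m -> forall a : 'I_3,
    free a (bound k).-1 && free a (bound k) = (a == gate k);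

  start_inj : injective start_cell;
  target_inj : injective target_cell;

  room_rectangle : exists a b : 'I_3, a <= b /\
    forall (r : 'I_3) c, c < bound 1 -> free r c = (a <= r <= b);
  room_starts : forall i, col (start_cell (inr i)) < bound 1;

  var_gadgets : forall v : 'I_n, let k := (var_order v).+1 in
    variable_gadget (bound k) (bound k.+1) (gate k) (gate k.+1) (var_gadget v);
  lit_starts : forall i j, let: (v, positive) := lit_at phi i j in
    start_cell (inl (i, j)) \in
      (if positive then vg_top (var_gadget v) else vg_bot (var_gadget v));

  clause_gates : forall i : 'I_m, gate (n.+1 + clause_order i) = bottom_row;
  clause_gadgets : forall i : 'I_m, let k := n.+1 + clause_order i in
    clause_gadget (bound k) (bound k.+1)
      (start_cell (inr i)) (target_cell (inr i))
      (fun j => target_cell (inl (i, j))) }.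

Definition instance_of n m (phi : formula3 n m) (K : construction phi) : mapf :=
  Mapf (@adjacent_sym _ (free K)) (@start_cell _ _ _ K) (@target_cell _ _ _ K).

(* Main.v *)
(* In a plan of cost [dstar] every agent follows a shortest path.  The first
   clause agent to move crosses each variable gadget along its top or bottom
   path, so all the literals starting there have moved before; declare them
   false.  Every clause agent has to pass a literal target of its gadget that is
   still empty, and the literal heading there moves later, hence is true.
   Conversely, given a satisfying assignment, the false literals move first,
   then the clause agents along the sides of the variable gadgets that are now
   clear, each through the target of a true literal, and the true literals move
   last; within these three groups, agents closer to the first clause gadget go
   first. *)
Require Import Defs.
From mathcomp Require Import all_boot.
From mathcomp Require Import perm zify.

Set Implicit Arguments.
Unset Strict Implicit.
Unset Printing Implicit Defensive.

(** * Shortest paths in a finite graph *)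

Section ShortestPaths.
Variables (T : finType) (e : rel T).
Implicit Types (u v x y : T) (p q : seq T).

Lemma walk_cat u x v p q :
  walk e u x p -> walk e x v q -> walk e u v (p ++ q).
Proof.
by case/andP=> ep /eqP lp /andP[eq lq]; rewrite /walk cat_path last_cat lp ep eq.
Qed.

Lemma dist_le_size u v p : walk e u v p -> dist e u v <= size p.
Proof.
move=> w; rewrite leqNgt; apply/negP=> lt_p.
have := before_find 0 lt_p; rewrite nth_iota ?add0n; last first.
  by apply: leq_trans lt_p _; rewrite -[X in _ <= X](size_iota 0) find_size.
by move/existsP; apply; exists (in_tuple p).
Qed.

Lemma shortest_path_exists u v p :
  walk e u v p -> exists q, shortest_path e u v q.
Proof.
case/andP=> ep /eqP <-; case/shortenP: ep => q eq uq _.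
(* [dist] only tries lengths below [#|T|]; the shortened walk repeats no vertex, so its length is
   among them. *)
have hq : has (fun k => [exists s : k.-tuple T, walk e u (last u q) s])
              (iota 0 #|T|).
  apply/hasP; exists (size q).
    rewrite mem_iota /= add0n cardE -[_ < _]/(size (u :: q) <= _).
    by apply: uniq_leq_size => // x _; rewrite mem_enum.
  by apply/existsP; exists (in_tuple q); rewrite /walk eq eqxx.
have := nth_find 0 hq; rewrite nth_iota ?add0n; last first.
  by rewrite -[X in _ < X](size_iota 0) -has_find.
by case/existsP=> s ws; exists s; rewrite /shortest_path ws size_tuple /= eqxx.
Qed.

Lemma shortest_path_le u v p q :
  shortest_path e u v p -> walk e u v q -> size p <= size q.
Proof. by case/andP=> _ /eqP-> /dist_le_size. Qed.

Lemma shortest_pathP u v p : walk e u v p ->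
  (forall q, walk e u v q -> size p <= size q) -> shortest_path e u v p.
Proof.
move=> wp min_p; rewrite /shortest_path wp eqn_leq dist_le_size // andbT.
by have [q /andP[wq /eqP<-]] := shortest_path_exists wp; apply: min_p.
Qed.

(** [x] is a cut vertex: any walk from [u] to [v] splits there into two parts, which are no shorter
    than [p] and [q]. *)
Lemma shortest_cat u x v p q :
    (forall s, walk e u v s -> x \in u :: s) ->
  shortest_path e u x p -> shortest_path e x v q -> shortest_path e u v (p ++ q).
Proof.
move=> cut sp sq; have [wp _] := andP sp; have [wq _] := andP sq.
apply: shortest_pathP (walk_cat wp wq) _ => s ws; have := cut s ws.
case/andP: ws => es /eqP ls xs; case/splitPl: xs es ls => s1 s2 ls1.
rewrite cat_path last_cat ls1 => /andP[es1 es2] ls2; rewrite !size_cat leq_add //.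
  by apply: shortest_path_le sp _; rewrite /walk es1 ls1 /=.
by apply: shortest_path_le sq _; rewrite /walk es2 ls2 /=.
Qed.

Lemma shortest_suffix u v p x q :
  shortest_path e u v (p ++ x :: q) -> shortest_path e x v q.
Proof.
move=> s; have [] := andP s; rewrite /walk cat_path last_cat /=.
case/andP=> /and3P[ep ex eq] lq _; apply: shortest_pathP => [|q' /andP[eq' lq']].
  by rewrite /walk eq.
have := @shortest_path_le u v _ (p ++ x :: q') s.
rewrite !size_cat /= leq_add2l ltnS; apply.
by rewrite /walk cat_path last_cat /= ep ex eq'.
Qed.

(** Cutting out loops gives a walk inside [p]; by minimality it is as long as [p], so nothing was
    cut out. *)
Lemma shortest_uniq u v p : shortest_path e u v p -> uniq (u :: p).
Proof.
move=> s; have [/andP[ep /eqP lp] _] := andP s.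
have le_p q := @shortest_path_le u v p q s; move: le_p; rewrite -lp.
case/shortenP: ep => q eq /= /andP[uNq uq] sub_qp le_p.
have le_pq: size p <= size q by apply: le_p; rewrite /walk eq /=.
have [_ eq_qp] := uniq_min_size uq sub_qp le_pq.
by rewrite (leq_size_uniq uq sub_qp le_pq) -eq_qp uNq.
Qed.

(** Used to order agents of the same group: a start cell met on the way is closer to the common
    goal. *)
Lemma dist_decreasing u v p x :
  shortest_path e u v p -> x \in p -> dist e x v < dist e u v.
Proof.
move=> s xp; have [_ /eqP <-] := andP s; case/splitPr: xp s => p1 p2.
move=> /shortest_suffix /andP[_ /eqP <-]; rewrite size_cat /=; lia.
Qed.

(* Steepest descent of [h] inside [S]; as [h] drops by at most 1 along an edge,
   it is a lower bound for the distance to [v]. *)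
Lemma shortest_descent (h : T -> nat) (S : T -> Prop) v :
    (forall x y, e x y -> h x <= (h y).+1) -> h v = 0 ->
    (forall x, S x -> x <> v -> exists y, [/\ S y, e x y & h x = (h y).+1]) ->
  forall x, S x ->
  exists2 p, shortest_path e x v p & forall y, y \in p -> S y.
Proof.
move=> lip hv step x Sx.
have [p [wp sz_p Sp]] : exists p, [/\ walk e x v p, size p = h x
                                    & forall y, y \in p -> S y].
  have [k hx] : exists k, h x = k by exists (h x).
  elim: k x Sx hx => [|k IH] x Sx hx.
    have [->|/eqP/(step _ Sx)[y []]] := eqVneq x v; last by rewrite hx.
    by exists [::]; split=> //; rewrite /walk /=.
  have [xv|/eqP/(step _ Sx)[y [Sy exy]]] := eqVneq x v; first by rewrite xv hv in hx.
  rewrite hx => -[hy]; have [p [wp sz_p Sp]] := IH y Sy (esym hy).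
  exists (y :: p); split; rewrite /= ?sz_p -?hy //.
    by move: wp; rewrite /walk /= exy.
  by move=> z; rewrite inE => /predU1P[->|/Sp].
exists p => //; apply: shortest_pathP wp _ => q /andP[eq /eqP lq].
rewrite sz_p -[size q]addn0 -hv -lq; elim: q x eq {Sx sz_p lq} => //= y q IH x.
by case/andP=> /lip hxy /IH; lia.
Qed.
End ShortestPaths.

(** * Grid paths through one-cell gates *)

Section GridPaths.
Variables (W : nat) (free : 'I_3 -> nat -> bool).
Implicit Types (u v x y : cell W free) (p q : seq (cell W free)).
Local Notation adj := (@adjacent W free).

Lemma cell_eq x y : row x = row y -> col x = col y -> x = y.
Proof.
rewrite /row /col => rxy cxy; apply: val_inj.
by rewrite [val x]surjective_pairing [val y]surjective_pairing rxy (val_inj cxy).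
Qed.

Lemma cell_exists r c : c < W -> free r c ->
  exists2 x : cell W free, row x = r & col x = c.
Proof. by move=> ltcW frc; exists (Sub (r, Ordinal ltcW) frc). Qed.

Lemma cell_free x : free (row x) (col x).
Proof. exact: (valP x). Qed.

Lemma col_ltW x : col x < W.
Proof. exact: ltn_ord. Qed.

(** Only equations between natural numbers remain, so that [lia] can reason about adjacency. *)
Lemma adjacentE x y : adj x y =
  (row x == row y :> nat) && ((col x).+1 == col y) ||
  (row x == row y :> nat) && ((col y).+1 == col x) ||
  (col x == col y) && ((row x).+1 == row y :> nat) ||
  (col x == col y) && ((row y).+1 == row x :> nat).
Proof. by rewrite /adjacent /consecutive -val_eqE !andb_orr !orbA. Qed.

(** A step changes the column by at most one, so the first step that reaches column [b] stays in its
    row and joins two free cells across the boundary; the gate hypothesis leaves only row [g]. The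
    path is split at this step. *)
Lemma crossing b g u p : (forall a, free a b.-1 && free a b = (a == g)) ->
    path adj u p -> col u < b <= col (last u p) ->
  exists p1 y p2, [/\ p = p1 ++ y :: p2, row (last u p1) = g,
    (col (last u p1)).+1 = b, row y = g & col y = b].
Proof.
move=> gate; elim: p u => [|z p IH] u /=; first lia.
case/andP=> euz ep /andP[ltub leb].
have [ltzb|lebz] := ltnP (col z) b.
  have [|p1 [y [p2 [-> rl cl ry cy]]]] := IH z ep; first by rewrite ltzb.
  by exists (z :: p1), y, p2; split.
have [ruz cu cz] : [/\ row u = row z, (col u).+1 = b & col z = b].
  move: euz; rewrite adjacentE => euz.
  by split; [apply: val_inj => /=| |]; lia.
have rz : row z = g.
  apply/eqP; rewrite -gate -{2}cz cell_free -ruz.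
  by rewrite -cu /= cell_free.
by exists [::], z, p; split; rewrite //= ruz.
Qed.

Lemma walk_through_gate b g u x y w s :
    (forall a, free a b.-1 && free a b = (a == g)) ->
    (col x).+1 = b -> row x = g -> col y = b -> row y = g ->
    col u < b -> b <= col w -> walk adj u w s -> x \in u :: s /\ y \in u :: s.
Proof.
move=> gate cx rx cy ry ltub lebw /andP[es /eqP ls]; rewrite -ls in lebw.
have [|p1 [z [p2 [-> rl cl rz cz]]]] := crossing gate es; first by rewrite ltub.
have -> : x = last u p1.
  by apply: cell_eq; [rewrite rl | apply: succn_inj; rewrite cl].
have -> : y = z by apply: cell_eq; congruence.
by rewrite -cat_cons !mem_cat mem_last !inE eqxx orbT.
Qed.

(** Both cells of the gate are cut vertices, so [shortest_cat] applies at [x] and then at [y]. *)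
Lemma shortest_through_gate b g u x y v p q :
    (forall a, free a b.-1 && free a b = (a == g)) ->
    (col x).+1 = b -> row x = g -> col y = b -> row y = g -> b <= col v ->
    col u < b -> shortest_path adj u x p -> shortest_path adj y v q ->
  shortest_path adj u v (p ++ y :: q).
Proof.
move=> gate cx rx cy ry lebv ltub sp sq.
have cross w s : b <= col w -> walk adj u w s -> x \in u :: s /\ y \in u :: s.
  exact: walk_through_gate gate cx rx cy ry ltub.
have sxy : shortest_path adj x y [:: y].
  apply: shortest_pathP => [|[|//]].
    by rewrite /walk /= eqxx !andbT adjacentE rx ry cx cy !eqxx.
  by rewrite /walk /= => /eqP xy; move: cx; rewrite xy cy => /esym/n_Sn.
have suy : shortest_path adj u y (p ++ [:: y]).
  by apply: shortest_cat sp sxy => s /cross[|//]; lia.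
by rewrite -cat_rcons -cats1; apply: shortest_cat suy sq => s /cross[|//].
Qed.
End GridPaths.

(** * Merging consecutive repetitions *)

Section Destutter.
Variables (T : eqType) (e : rel T).
Implicit Types (x y : T) (s : seq T).

Lemma destutter_path x s :
  path (fun y z => (y == z) || e y z) x s -> path e x (destutter x s).
Proof.
elim: s x => //= y s IH x; have [<- /IH //|_ /= /andP[-> /IH //]] := eqVneq x y.
Qed.

Lemma last_destutter x s : last x (destutter x s) = last x s.
Proof. by elim: s x => //= y s IH x; have [<-|_] := eqVneq x y; rewrite /= IH. Qed.

Lemma mem_destutter x s : x :: destutter x s =i x :: s.
Proof.
elim: s x => //= y s IH x z; have [<-|_] := eqVneq x y.
  by rewrite IH !inE orbA orbb.
by rewrite inE IH !inE.
Qed.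

Lemma destutter_nseq k x s :
  destutter x (nseq k x ++ s) = destutter x s.
Proof. by elim: k => //= k IH; rewrite eqxx. Qed.

Lemma destutter_id x s : uniq (x :: s) -> destutter x s = s.
Proof.
elim: s x => //= y s IH x /andP[]; rewrite inE => /norP[/negPf-> _] us.
by rewrite IH.
Qed.
End Destutter.

(** * Paths of a motion plan and optimal cost *)

Section Plans.
Variable M : mapf.
Implicit Types (r : agent M) (plan : agent M -> nat -> vertex M).
Local Notation shortest r := (shortest_path (@edge M) (start r) (target r)).

Lemma path_of_walk r pi p : trajectory r pi -> path_of pi p ->
  walk (@edge M) (start r) (target r) p /\
  forall x, x \in start r :: p -> exists t, pi t = x.
Proof.
case=> pi0 [T0 piT0] step [T piT ->]; rewrite -pi0; split; last first.
  move=> x; rewrite mem_destutter inE => /predU1P[->|]; first by exists 0.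
  by case/mapP=> t _ ->; exists t.+1.
rewrite /walk last_destutter; apply/andP; split.
  apply: destutter_path; elim: T 0 {piT} => //= T IH t; rewrite IH andbT.
  by apply/orP; case: (step t) => [->|->]; [left | right].
have -> : last (pi 0) [seq pi t.+1 | t <- iota 0 T] = pi T.
  by case: T {piT} => // T; rewrite -addn1 iotaD map_cat last_cat /= add0n addn1.
(* The time [T] of the path and the time [T0] of the trajectory are unrelated; they are compared at
   their maximum. *)
by rewrite -(piT _ (leq_maxl T T0)) piT0 // leq_maxr.
Qed.

(** Each path is at least as long as the distance between its ends, so equality of the sums forces
    equality for each agent. *)
Lemma optimal_paths plan :
    motion_plan plan -> distance_cost plan (dstar M) ->
  exists p, forall r, path_of (plan r) (p r) /\ shortest r (p r).
Proof.
move=> mp [p pathp cost]; exists p => r; split=> //.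
have wp r' : walk (@edge M) (start r') (target r') (p r').
  by have [] := path_of_walk (mp r') (pathp r').
rewrite /shortest_path wp eq_sym /=; move/esym/eqP: cost.
have le_p r' : true -> dist (@edge M) (start r') (target r') <= size (p r')
    ?= iff (dist (@edge M) (start r') (target r') == size (p r')).
  by move=> _; apply/leqif_eq/dist_le_size.
rewrite /dstar eq_sym.
by have [_ ->] := leqif_sum le_p => /forallP/(_ r).
Qed.

(** * Active intervals and the order of the moves *)

Section Activity.
Variable plan : agent M -> nat -> vertex M.
Hypotheses (plan_motion : motion_plan plan) (plan_free : collision_free plan).
Hypotheses (plan_monotone : monotone plan).
Hypothesis start_neq_target : forall r, start r != target r.

(** As start and target differ, the agent leaves and arrives, so the minimum and the maximum
    exist. *)
Lemma active_interval r : exists I : nat * nat,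
  [/\ I.1 < I.2, forall t, I.1 <= t <= I.2 -> active plan r t,
      forall t, t <= I.1 -> plan r t = start r
    & forall t, I.2 <= t -> plan r t = target r].
Proof.
have [pi0 [T piT] _] := plan_motion r.
pose leaves s := plan r s.+1 != start r.
pose arrives s := (0 < s) && (plan r s.-1 != target r).
have exL : exists s, leaves s.
  by exists T; rewrite /leaves piT // eq_sym start_neq_target.
have exA : exists s, arrives s by exists 1; rewrite /arrives /= pi0.
have maxA s : arrives s -> s <= T.
  case/andP=> s_gt0; rewrite leqNgt; apply: contra => ltTs.
  by rewrite piT //; lia.
case: (ex_minnP exL) => a La min_a; case: (ex_maxnP exA maxA) => b Ab max_b.
have atS t : t <= a -> plan r t = start r.
  case: t => // t lt_ta; apply/eqP/negbNE; apply/negP=> /min_a; lia.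
have atT t : b <= t -> plan r t = target r.
  move=> le_bt; apply/eqP/negbNE; apply/negP=> Nt.
  by have := max_b t.+1; rewrite /arrives /= => /(_ Nt); lia.
(* At time [a] the agent is still at its start, hence not at its target, so [a.+1] is a candidate
   for the maximum [b]. *)
exists (a, b); split=> //=; first by apply: max_b; rewrite /arrives /= atS.
move=> t abt; exists a, b; split=> //; split.
- by apply/eqP.
- by move=> s /eqP; apply: min_a.
- by case/andP: Ab => ? /eqP.
by move=> s [s_gt0 /eqP Ns]; apply: max_b; rewrite /arrives s_gt0.
Qed.

Lemma active_intervals : exists A B : agent M -> nat,
  [/\ forall r, A r < B r,
      forall r r', r != r' -> B r < A r' \/ B r' < A r,
      forall r t, t <= A r -> plan r t = start r
    & forall r t, B r <= t -> plan r t = target r].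
Proof.
have [I IP] := fin_all_exists active_interval.
exists (fun r => (I r).1), (fun r => (I r).2); split=> [r|r r' /eqP neq|r|r].
- by case: (IP r).
- have [ltI act _ _] := IP r; have [ltI' act' _ _] := IP r'.
  (* Two overlapping intervals would share the larger of their left ends. *)
  have disj := plan_monotone neq (t := maxn (I r).1 (I r').1).
  have [|le1] := ltnP (I r).2 (I r').1; first by left.
  have [|le2] := ltnP (I r').2 (I r).1; first by right.
  by case: disj; split; [apply: act | apply: act']; lia.
- by case: (IP r).
by case: (IP r).
Qed.

(** [A r] is the left end of the active interval. When [r] meets the start of [r'], that agent must
    already have left; when it meets the target, that agent must not have arrived. Disjointness of
    the intervals turns this into an order. *)
Lemma moving_order (p : agent M -> seq (vertex M)) :
    (forall r, path_of (plan r) (p r)) ->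
  exists A : agent M -> nat, forall r r', r <> r' ->
    (start r' \in start r :: p r -> A r' < A r) /\
    (target r' \in start r :: p r -> A r < A r').
Proof.
move=> pathp; have [A [B [ltAB disj atS atT]]] := active_intervals.
exists A => r r' neq; have [Nv _] := plan_free neq.
(* Outside its interval [r] sits on its start or target, where it also is at times [A r] and [B r];
   so times inside the interval suffice. *)
have visit x : x \in start r :: p r -> exists2 t, A r <= t <= B r & plan r t = x.
  have [_ in_p] := path_of_walk (plan_motion r) (pathp r).
  have ltr := ltAB r; move=> /in_p [t <-].
  have [/ltnW le_tA|le_At] := ltnP t (A r).
    by exists (A r); rewrite ?leqnn ?(ltnW ltr) // !atS.
  have [/ltnW le_Bt|le_tB] := ltnP (B r) t; last by exists t; rewrite ?le_At.
  by exists (B r); rewrite ?leqnn ?(ltnW ltr) // !atT.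
have ltr := ltAB r; have ltr' := ltAB r'.
split=> /visit [t t_in plan_t]; case: (disj r r' (introN eqP neq)) => lt; try lia.
- by case: (Nv t); rewrite plan_t atS //; lia.
- by case: (Nv t); rewrite plan_t atT //; lia.
Qed.
End Activity.

(* Agent [r] moves along [p r] during the time slot of length [L] given by its
   rank in the order of the keys. *)
Lemma sequential_plan (key : agent M -> nat) (p : agent M -> seq (vertex M)) :
    (forall r, shortest r (p r)) ->
    (forall r r', r <> r' -> key r <= key r' ->
       start r' \notin start r :: p r /\ target r \notin start r' :: p r') ->
  exists plan, [/\ motion_plan plan, collision_free plan, monotone plan
                 & distance_cost plan (dstar M)].
Proof.
move=> sp avoid.
pose s := sort (relpre key leq) (enum (agent M)).
have s_all r : r \in s by rewrite mem_sort mem_enum.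
have ss : sorted (relpre key leq) s by apply: sort_sorted => x y; apply: leq_total.
have key_rank r r' : index r s < index r' s -> key r <= key r'.
  move=> lt; have tr : transitive (relpre key leq) by move=> x y z; apply: leq_trans.
  by have /= := sorted_ltn_index tr ss _ _ (s_all r) (s_all r') lt.
(* The successor makes a slot longer than every path, so that closed active intervals in successive
   slots share no end point. *)
pose L := (\max_r size (p r)).+1; pose slot r := index r s * L.
have ltL r : size (p r) < L by rewrite ltnS (leq_bigmax r).
have slot_lt r r' : index r s < index r' s -> slot r + L <= slot r'.
  by move=> lt; rewrite /slot addnC -mulSn leq_mul2r lt orbT.
have total r r' : r <> r' -> index r s < index r' s \/ index r' s < index r s.
  move=> neq; case: (ltngtP (index r s) (index r' s)); [by left | by right |].
  by move=> eq; case: neq; rewrite -(nth_index r (s_all r)) eq nth_index.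
(* Truncated subtraction keeps [r] at its start before its slot, and the default value of [nth]
   keeps it at its target once the path is used up. *)
pose plan r t := nth (target r) (start r :: p r) (t - slot r).
have at_start r t : t <= slot r -> plan r t = start r.
  by rewrite -subn_eq0 /plan => /eqP->.
have plan_end r : nth (target r) (start r :: p r) (size (p r)) = target r.
  have [/andP[_ /eqP lp] _] := andP (sp r).
  by rewrite -[size (p r)]/(size (start r :: p r)).-1 nth_last.
have at_target r t : slot r + size (p r) <= t -> plan r t = target r.
  move=> le_t; have := plan_end r; rewrite /plan.
  have [->//|lt _] := eqVneq (t - slot r) (size (p r)).
  by rewrite nth_default //=; lia.
have on_path r t : plan r t \in start r :: p r.
  have [lt|le] := ltnP (t - slot r) (size (p r)).+1; first exact: mem_nth.
  by rewrite at_target; [rewrite -plan_end mem_nth | lia].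
have slot_bounds r t : active plan r t -> slot r <= t <= slot r + size (p r).
  case=> a [b [[Pa _] [[b_gt0 Pb] _] /andP[le_at le_tb]]].
  apply/andP; split.
    apply: leq_trans le_at; rewrite leqNgt; apply/negP=> lt; apply: Pa.
    exact: at_start.
  apply: leq_trans le_tb _; rewrite leqNgt; apply/negP=> lt; apply: Pb.
  by apply: at_target; lia.
have no_collision r r' : index r s < index r' s ->
    (forall t, plan r t <> plan r' t) /\
    (forall t, (plan r t, plan r t.+1) <> (plan r' t.+1, plan r' t)).
  move=> lt; have le_slot := slot_lt _ _ lt; have lt_L := ltL r.
  have neq : r <> r' by move=> eq; rewrite eq ltnn in lt.
  have [Ns Nt] := avoid r r' neq (key_rank _ _ lt).
  have Ns' t : plan r t <> start r' by move=> eq; move: Ns; rewrite -eq on_path.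
  have Nt' t : plan r' t <> target r by move=> eq; move: Nt; rewrite -eq on_path.
  (* Up to time [slot r'] agent [r'] waits at its start; from then on [r] rests at its target. *)
  split=> t.
    have [le_t|lt_t] := leqP t (slot r'); first by rewrite (at_start r') //; apply: Ns'.
    by rewrite (at_target r); [apply/nesym/Nt' | lia].
  have [lt_t|le_t] := ltnP t (slot r'); first by rewrite (at_start r' t.+1) // => -[/Ns'].
  by rewrite (at_target r t) => [[/esym/Nt']|]; [| lia].
exists plan; split.
- move=> r; split; first exact: at_start.
    by exists (slot r + size (p r)); apply: at_target.
  move=> t; have [le_t|le_t] := leqP (slot r + size (p r)) t.
    by left; rewrite !at_target // ltnW.
  have [lt_t|{}le_t'] := ltnP t (slot r).
    by left; rewrite !at_start // ltnW.
  right; have [/andP[/(pathP (target r)) ep _] _] := andP (sp r).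
  by rewrite /plan subSn //=; apply: ep; lia.
- move=> r r' /[dup] neq /total[/no_collision//|/no_collision[Nv Ne]].
  split=> t; first exact/nesym/Nv.
  by case=> e1 e2; apply: (Ne t); rewrite e1 e2.
- move=> r r' neq t [/slot_bounds b1 /slot_bounds b2].
  have := ltL r; have := ltL r'.
  by case: (total r r' neq) => /slot_lt; lia.
exists p => [r|]; last first.
  by apply: eq_bigr => r _; have [_ /eqP] := andP (sp r).
exists (slot r + size (p r)).
  by move=> t le_t; rewrite !at_target.
have -> : [seq plan r t.+1 | t <- iota 0 (slot r + size (p r))]
          = nseq (slot r) (start r) ++ p r.
  apply: (@eq_from_nth _ (target r)).
    by rewrite size_map size_iota size_cat size_nseq.
  move=> i; rewrite size_map size_iota => lt_i.
  rewrite (nth_map 0) ?size_iota // nth_iota // add0n nth_cat size_nseq nth_nseq.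
  have [lt|le] := ltnP i (slot r); first by rewrite at_start.
  by rewrite /plan subSn.
by rewrite at_start // destutter_nseq destutter_id // (shortest_uniq (sp r)).
Qed.
End Plans.

(** * Crossing a variable gadget *)

Section VariableGadget.
Variables (W : nat) (free : 'I_3 -> nat -> bool).
Variables (l r : nat) (rl rr : 'I_3) (g : vgadget W free).
Hypotheses (ltlr : l < r) (g_ok : variable_gadget l r rl rr g).
Local Notation adj := (@adjacent W free).

(** Indexed by the sign of a literal: literals of sign [b] start on [side b]. *)
Definition side (b : bool) := if b then vg_top g else vg_bot g.
Definition side_path (b : bool) :=
  vg_pre g ++ side b ++ rcons (vg_post g) (exit g).

Lemma side_path_shortest b :
  shortest_path adj (entrance g) (exit g) (side_path b).
Proof. by case: b; [apply: (vg_top_shortest g_ok) | apply: (vg_bot_shortest g_ok)]. Qed.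

Lemma side_path_inside b x : x \in entrance g :: side_path b -> l <= col x < r.
Proof.
have [cl _] := vg_entrance g_ok.
rewrite inE => /predU1P[->|xb]; first by rewrite cl leqnn.
apply: (allP (vg_inside g_ok)); rewrite mem_cat.
by case: b xb => xb; apply/orP; [left | right].
Qed.

Lemma side_sub_path b x : x \in side b -> x \in side_path b.
Proof. by rewrite /side_path !mem_cat => ->; rewrite orbT. Qed.

(** A shortest path has no repetition, so [x] is not in the shared parts; [vg_separate] keeps it off
    the other side. *)
Lemma side_notin_path b x :
  x \in side b -> x \notin entrance g :: side_path (~~ b).
Proof.
move=> xb; have := shortest_uniq (side_path_shortest b).
have Nx : x \notin side (~~ b).
  apply/negP=> xNb; case/negP: (vg_separate g_ok).
  by case: b xb xNb => /= h1 h2; apply/hasP; exists x.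
rewrite /side_path !inE; set post := rcons _ _.
rewrite cons_uniq uniq_catCA cat_uniq !mem_cat !negb_or (negPf Nx) /=.
case/andP=> /and3P[_ Nent _] /and3P[_ /hasPn Nb _].
have Nb' y : y \in vg_pre g ++ post -> y != x.
  by move/Nb; apply: contraNneq => ->.
apply/and3P; split.
- by apply: contraNneq Nent => <-.
- by apply/negP=> xp; have := Nb' x; rewrite mem_cat xp eqxx => /(_ isT).
by apply/negP=> xp; have := Nb' x; rewrite mem_cat xp orbT eqxx => /(_ isT).
Qed.

(** The path crosses the gates at [l] and [r]. The piece between the two crossings is a simple walk
    from entrance to exit, hence one of the two paths of the gadget by [vg_only]. *)
Lemma gadget_traversed u p :
    (forall a, free a l.-1 && free a l = (a == rl)) ->
    (forall a, free a r.-1 && free a r = (a == rr)) ->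
    path adj u p -> uniq (u :: p) -> col u < l -> r <= col (last u p) ->
  exists b, {subset side b <= p}.
Proof.
move=> gate_l gate_r ep up ltul lerp.
have [cl rowl] := vg_entrance g_ok; have [cr rowr] := vg_exit g_ok.
have [|p1 [y [p2 [def_p _ _ ry cy]]]] := crossing gate_l ep.
  by rewrite ltul (leq_trans (ltnW ltlr)).
have ent : y = entrance g by apply: cell_eq; congruence.
subst y; move: ep lerp; rewrite def_p cat_path last_cat /= => /and3P[_ _ ep2] lerp.
have [|p3 [z [p4 [def_p2 r3 c3 _ _]]]] := crossing gate_r ep2.
  by rewrite cl ltlr.
have last3 : last (entrance g) p3 = exit g.
  by apply: cell_eq; [congruence | apply: succn_inj; rewrite c3].
have w3 : walk adj (entrance g) (exit g) p3.
  by move: ep2; rewrite /walk def_p2 cat_path last3 eqxx andbT => /andP[].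
have u3 : uniq (entrance g :: p3).
  move: up; rewrite def_p def_p2 -cat_cons cat_uniq => /and3P[_ _].
  by rewrite -cat_cons cat_uniq => /and3P[].
have [b def3] : exists b, p3 = side_path b.
  by case: (vg_only g_ok w3 u3) => ->; [exists true | exists false].
exists b => x /side_sub_path; rewrite -def3 def_p2 => x3.
by rewrite !(mem_cat, inE) x3 !orbT.
Qed.
End VariableGadget.

(** * Positions of gadgets, starts and targets *)

Section Instance.
Variables (n m : nat) (phi : formula3 n m) (K : construction phi).
Local Notation W := (bound K (n + m).+1).
Local Notation cellK := (cell W (free K)).
Local Notation adj := (@adjacent W (free K)).
Local Notation gadget v := (var_gadget K v).
Local Notation lit_start i j := (start_cell K (inl (i, j))).
Local Notation lit_target i j := (target_cell K (inl (i, j))).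
Local Notation clause_start i := (start_cell K (inr i)).
Local Notation clause_target i := (target_cell K (inr i)).
Implicit Types (v : 'I_n) (i : 'I_m) (j : 'I_3) (x y : cellK) (b : bool).

Lemma bound_le k k' : k <= k' <= (n + m).+1 -> bound K k <= bound K k'.
Proof.
case/andP=> /subnK <-; elim: (k' - k) => // d IH; rewrite addSn => lt.
by apply: leq_trans (IH (ltnW lt)) _; apply/ltnW/(bound_lt K).
Qed.

Lemma section_unique k k' c : k <= n + m -> k' <= n + m ->
    bound K k <= c < bound K k.+1 -> bound K k' <= c < bound K k'.+1 -> k = k'.
Proof.
move=> le_k le_k' c_k c_k'; case: (ltngtP k k') => // lt.
  have : bound K k.+1 <= bound K k' by apply: bound_le; lia.
  lia.
have : bound K k'.+1 <= bound K k by apply: bound_le; lia.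
lia.
Qed.

Lemma gateP k : 0 < k <= n + m ->
  forall a, free K a (bound K k).-1 && free K a (bound K k) = (a == gate K k).
Proof. exact: gate_unique. Qed.

Lemma gate_cell k : 0 < k <= n + m ->
  exists2 y : cellK, row y = gate K k & col y = bound K k.
Proof.
move=> k_in; apply: cell_exists.
  by apply: leq_trans (bound_lt K (k := k) _) (bound_le _); lia.
by have := gateP k_in (gate K k); rewrite eqxx => /andP[].
Qed.

Lemma gadget_section v : 0 < (var_order K v).+1 <= n /\ 
  bound K (var_order K v).+1 < bound K (var_order K v).+2.
Proof.
have lt := ltn_ord (var_order K v); split=> //.
by apply: bound_lt; apply: leq_trans lt (leq_addr _ _).
Qed.

Lemma side_cols v b x : x \in side (gadget v) b ->
  bound K (var_order K v).+1 <= col x < bound K (var_order K v).+2.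
Proof.
move=> xb; have [_ lt] := gadget_section v.
apply: (side_path_inside lt (var_gadgets K v) (b := b)).
by rewrite inE side_sub_path ?orbT.
Qed.

Lemma gadget_inj v v' c :
    bound K (var_order K v).+1 <= c < bound K (var_order K v).+2 ->
    bound K (var_order K v').+1 <= c < bound K (var_order K v').+2 ->
  v = v'.
Proof.
have lt_v := ltn_ord (var_order K v); have lt_v' := ltn_ord (var_order K v').
move=> cv cv'; have : (var_order K v).+1 = (var_order K v').+1.
  by apply: section_unique cv cv'; lia.
by case=> /val_inj/perm_inj.
Qed.

Lemma lit_start_side i j :
  lit_start i j \in side (gadget (lit_at phi i j).1) (lit_at phi i j).2.
Proof. by have := lit_starts K i j; case: (lit_at phi i j) => v []. Qed.

Lemma clause_section i : n < n.+1 + clause_order K i <= n + m.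
Proof. by have := ltn_ord (clause_order K i); lia. Qed.

Lemma lit_target_col i j :
  bound K (n.+1 + clause_order K i) <= col (lit_target i j) <= col (clause_target i).
Proof. exact: (cg_columns (clause_gadgets K i) j). Qed.

Lemma clause_target_col i :
  bound K (n.+1 + clause_order K i) <= col (clause_target i)
    < bound K (n.+1 + clause_order K i).+1.
Proof.
have := lit_target_col i ord0; have := cg_right (clause_gadgets K i); lia.
Qed.

(** Column [bound K n.+1] begins the clause gadgets. Together with [start_col] this separates starts
    from targets and forces every route through the gate there. *)
Lemma target_col r : bound K n.+1 <= col (target_cell K r).
Proof.
have le i : bound K n.+1 <= bound K (n.+1 + clause_order K i).
  by apply: bound_le; have := clause_section i; lia.
case: r => [[i j]|i]; apply: leq_trans (le i) _.
  by have := lit_target_col i j; lia.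
by have := clause_target_col i; lia.
Qed.

Lemma start_col r : col (start_cell K r) < bound K n.+1.
Proof.
case: r => [[i j]|i]; last first.
  by apply: leq_trans (room_starts K i) (bound_le _); lia.
have /side_cols := lit_start_side i j; set v := _.1.
have := ltn_ord (var_order K v) => lt.
by have : bound K (var_order K v).+2 <= bound K n.+1 by [apply: bound_le; lia]; lia.
Qed.

Lemma start_neq_target r r' : start_cell K r != target_cell K r'.
Proof.
by apply: contraTneq (start_col r) => ->; rewrite -leqNgt target_col.
Qed.

(** * From a plan to a satisfying assignment *)

Lemma plan_satisfiable plan :
    motion_plan (M := instance_of K) plan -> collision_free plan ->
    monotone plan -> distance_cost plan (dstar (instance_of K)) ->
  satisfiable phi.
Proof.
move=> mp cf mono cost.
(* Without clauses there is no first clause agent, and any assignment will do. *)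
have [m0|m_gt0] := posnP m.
  by exists (fun=> true) => i; have := ltn_ord i; rewrite {2}m0.
have [p pP] := optimal_paths mp cost.
have [A order] := moving_order mp cf mono (fun r => start_neq_target r r)
  (fun r => (pP r).1).
pose first := [arg min_(i < Ordinal m_gt0) A (inr i)].
have first_le i : A (inr first) <= A (inr i).
  by rewrite /first; case: arg_minnP => // i0 _; apply.
have [/andP[ep /eqP lp] _] := andP (pP (inr first)).2.
have cleared v : exists b, {subset side (gadget v) b <= p (inr first)}.
  have [/andP[_ le_n] lt] := gadget_section v.
  apply: (gadget_traversed lt (var_gadgets K v) _ _ ep).
  - by apply: gateP; lia.
  - by apply: gateP; lia.
  - exact: shortest_uniq (pP (inr first)).2.
  - by apply: leq_trans (room_starts K first) (bound_le _); lia.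
  rewrite lp; apply: leq_trans (target_col _); apply: bound_le; lia.
have [a aP] := fin_all_exists cleared.
(* [a v] is a side swept by the first clause agent; the literals starting there become false. *)
exists (fun v => ~~ a v) => i.
have [j tj] := cg_through (clause_gadgets K i) (pP (inr i)).2.
exists j; apply/eqP; rewrite -[_ == _]negbK; apply/negP => neq.
have lit_a : a (lit_at phi i j).1 = (lit_at phi i j).2.
  by case: (a _) (_.2) neq => [] [].
have := lit_start_side i j; rewrite -lit_a => /aP visited.
(* If the literal were false, its agent would start before [first], yet after the clause agent [i],
   which passes its target; but [first] is the earliest clause agent. *)
have [|before _] := order (inr first) (inl (i, j)); first by [].
have [|_ after] := order (inr i) (inl (i, j)); first by [].
have := before; rewrite inE visited orbT => /(_ isT).
have := after; rewrite inE tj orbT => /(_ isT).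
have := first_le i; lia.
Qed.

(** * Routes from the starts to the clause gadgets, for a given assignment *)

Section Schedule.
Variable a : 'I_n -> bool.
Hypothesis m_gt0 : 0 < m.
(** The common cell just right of the gate to the clause gadgets; every route is built as a path to
    [z0] followed by a path from it. *)
Variable z0 : cellK.
Hypotheses (row_z0 : row z0 = bottom_row) (col_z0 : col z0 = bound K n.+1).

(** The sides on which the true literals start. These move last, so the routes of false literals and
    clause agents must avoid such cells. *)
Definition kept x : Prop := exists v, x \in side (gadget v) (a v).

Lemma kept_cols x : kept x -> bound K 1 <= col x < bound K n.+1.
Proof.
case=> v /side_cols; have lt := ltn_ord (var_order K v).
have : bound K 1 <= bound K (var_order K v).+1 by apply: bound_le; lia.
have : bound K (var_order K v).+2 <= bound K n.+1 by apply: bound_le; lia.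
lia.
Qed.

Lemma kept_notin v x :
  x \in entrance (gadget v) :: side_path (gadget v) (~~ a v) -> ~ kept x.
Proof.
move=> xv [v' xv']; have [_ lt] := gadget_section v.
have eq_v := gadget_inj (side_path_inside lt (var_gadgets K v) xv) (side_cols xv').
subst v'; by have := side_notin_path (var_gadgets K v) xv'; rewrite xv.
Qed.

Lemma gate_bottom : gate K n.+1 = bottom_row.
Proof.
have := clause_gates K ((clause_order K)^-1%g (Ordinal m_gt0)).
by rewrite permKV addn0.
Qed.

(** Induction on the number [n - k] of gadgets still ahead: each is crossed along its side [~~ a v],
    and the pieces are glued at the gates. *)
Lemma tail_path k y : k <= n -> col y = bound K k.+1 -> row y = gate K k.+1 ->
  exists2 q, shortest_path adj y z0 q &
    forall x, x \in y :: q -> [/\ bound K k.+1 <= col x,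
      col x < bound K n.+1 \/ x = z0 & ~ kept x].
Proof.
have [d dk] : exists d, d = n - k by exists (n - k).
elim: d k y dk => [|d IH] k y dk le_kn cy ry.
  have eq_k : k = n by lia.
  subst k; have -> : y = z0 by apply: cell_eq; rewrite ?ry ?gate_bottom ?cy.
  exists [::]; first by apply: shortest_pathP; rewrite /walk /=.
  move=> x; rewrite inE => /eqP->; rewrite col_z0; split=> //; first by right.
  by move/kept_cols; lia.
have lt_kn : k < n by lia.
(* The variable whose gadget is section [k.+1], entered at [y]. *)
pose v := (var_order K)^-1%g (Ordinal lt_kn).
have def_v : var_order K v = k :> nat by rewrite permKV.
have [_ lt] := gadget_section v; have g_ok := var_gadgets K v.
have [ce re] := vg_entrance g_ok; have [cx rx] := vg_exit g_ok.
have sp := side_path_shortest g_ok (~~ a v).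
have inside := side_path_inside lt g_ok (b := ~~ a v).
rewrite /= def_v in lt ce re cx rx inside.
have [|y' ry' cy'] := @gate_cell k.+2; first lia.
have [q sq qP] := IH k.+1 y' ltac:(lia) lt_kn cy' ry'.
have ent : y = entrance (gadget v) by apply: cell_eq; congruence.
have le_n : bound K k.+2 <= bound K n.+1 by apply: bound_le; lia.
exists (side_path (gadget v) (~~ a v) ++ y' :: q).
  rewrite -ent in sp.
  apply: (shortest_through_gate (gateP (k := k.+2) _) cx rx cy' ry' _ _ sp sq).
  - lia.
  - by rewrite col_z0.
  - by rewrite cy.
move=> x; rewrite ent -cat_cons mem_cat => /orP[xv|/qP[? ? ?]]; last first.
  by split=> //; lia.
have := inside x xv => x_in; split; [lia | left; lia | exact: kept_notin xv].
Qed.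

(** The rest of the side path behind [s], then [tail_path]. Kept cells are avoided only by a false
    literal, since a true one travels along the kept side of its own gadget. *)
Lemma lit_to_clauses v b s : s \in side (gadget v) b ->
  exists2 q, shortest_path adj s z0 q &
    forall x, x \in s :: q -> [/\ bound K 1 <= col x,
      col x < bound K n.+1 \/ x = z0 & b = ~~ a v -> ~ kept x].
Proof.
move=> sb; have [/andP[_ le_n] lt] := gadget_section v.
have g_ok := var_gadgets K v; have [cx rx] := vg_exit g_ok.
have sp := side_path_shortest g_ok b.
have inside := side_path_inside lt g_ok (b := b).
have Nkept x : x \in side_path (gadget v) b -> b = ~~ a v -> ~ kept x.
  by move=> xb eq_b; apply: (@kept_notin v); rewrite -eq_b inE xb orbT.
have [|y ry cy] := @gate_cell (var_order K v).+2; first lia.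
have [q sq qP] := tail_path le_n cy ry.
have le1 : bound K 1 <= bound K (var_order K v).+1 by apply: bound_le; lia.
have le2 : bound K (var_order K v).+2 <= bound K n.+1 by apply: bound_le; lia.
have [p1 [p2 def_p]] : exists p1 p2, side_path (gadget v) b = p1 ++ s :: p2.
  by case/splitPr: (side_sub_path sb) => p1 p2; exists p1, p2.
rewrite def_p in sp inside Nkept.
have s_cols := side_cols sb.
exists (p2 ++ y :: q).
  apply: (shortest_through_gate (gateP (k := (var_order K v).+2) _) cx rx cy ry
    _ _ (shortest_suffix sp) sq).
  - lia.
  - by rewrite col_z0.
  - lia.
move=> x; rewrite -cat_cons mem_cat => /orP[x2|/qP[le_x x_lt x_kept]]; last first.
  by split=> //; lia.
have x_in : x \in p1 ++ s :: p2 by rewrite mem_cat x2 orbT.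
have := inside x; rewrite inE x_in orbT => /(_ isT) x_cols.
by split; [lia | left; lia | apply: Nkept].
Qed.

Lemma clause_to_clauses i :
  exists2 q, shortest_path adj (clause_start i) z0 q &
    forall x, x \in clause_start i :: q ->
      (col x < bound K n.+1 \/ x = z0) /\ ~ kept x.
Proof.
have gate1 := @gateP 1 ltac:(lia).
have [A [B [leAB room]]] := room_rectangle K.
have b1 : 0 < bound K 1 by rewrite -{1}(bound_0 K); apply: bound_lt; lia.
have b1W : bound K 1 <= W by apply: bound_le; lia.
have b1n : bound K 1 <= bound K n.+1 by apply: bound_le; lia.
have /andP[free_w _] : free K (gate K 1) (bound K 1).-1 && free K (gate K 1) (bound K 1).
  by rewrite gate1.
have [|w rw cw] := @cell_exists W (free K) (gate K 1) (bound K 1).-1 _ free_w.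
  lia.
have [y ry cy] := @gate_cell 1 ltac:(lia).
have gAB : A <= gate K 1 <= B by rewrite -(room _ (bound K 1).-1) //; lia.
pose g := gate K 1 : nat.
(* Manhattan distance to the exit cell [w]; of the two truncated differences of rows at most one is
   nonzero. In the obstacle-free rectangle it can always be decreased. *)
pose h x := bound K 1 - (col x).+1 + (row x - g + (g - row x)).
have room_row x : col x < bound K 1 -> A <= row x <= B.
  by move=> lt; rewrite -(room _ _ lt) cell_free.
have mk (r' : nat) c : A <= r' <= B -> c < bound K 1 ->
    exists2 x : cellK, row x = r' :> nat & col x = c.
  move=> r_in lt_c; have r_lt : r' < 3 by have := ltn_ord B; lia.
  have [||x rx cx] := @cell_exists W (free K) (Ordinal r_lt) c.
  - lia.
  - by rewrite room.
  by exists x; rewrite ?rx.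
have [|||q0 sq0 q0P] := @shortest_descent _ adj h
    (fun x => col x < bound K 1) w _ _ _ (clause_start i) (room_starts K i).
- by move=> x x'; rewrite adjacentE /h; lia.
- by rewrite /h cw rw /g; lia.
- move=> x Sx Nx; have x_rows := room_row x Sx.
  have [lt|ge] := ltnP (col x).+1 (bound K 1).
    have [x' rx' cx'] := mk (row x) (col x).+1 x_rows lt.
    by exists x'; rewrite adjacentE /h rx' cx'; split=> //; lia.
  have Nrow : row x <> g :> nat.
    by move=> eq_g; apply: Nx; apply: cell_eq; [apply: val_inj; rewrite rw | lia].
  have [lt_g|gt_g|//] := ltngtP (row x) g.
    have [|x' rx' cx'] := mk (row x).+1 (col x) _ Sx; first lia.
    by exists x'; rewrite adjacentE /h rx' cx'; split=> //; lia.
  have [|x' rx' cx'] := mk (row x).-1 (col x) _ Sx; first lia.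
  by exists x'; rewrite adjacentE /h rx' cx'; split=> //; lia.
have [q sq qP] := @tail_path 0 y (leq0n n) cy ry.
exists (q0 ++ y :: q).
  apply: (shortest_through_gate gate1 _ rw cy ry _ _ sq0 sq).
  - by rewrite cw; lia.
  - by rewrite col_z0.
  - exact: room_starts.
move=> x; rewrite -cat_cons mem_cat => /orP[x0|/qP[] //].
have x_lt : col x < bound K 1.
  by move: x0; rewrite inE => /predU1P[->|/q0P //]; apply: room_starts.
by split; [left; lia | move/kept_cols; lia].
Qed.

(** * Routes within the clause gadgets *)

Lemma bottom_free c : bound K n.+1 <= c < W -> free K bottom_row c.
Proof.
suff free_upto k : k <= m -> bound K n.+1 <= c < bound K (n.+1 + k) ->
    free K bottom_row c by apply: (free_upto m (leqnn m)).
elim: k => [|k IH] lt_km; first by rewrite addn0; lia.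
case/andP=> le_c lt; have [lt_k|le] := ltnP c (bound K (n.+1 + k)).
  by apply: IH; lia.
have := cg_bottom (clause_gadgets K ((clause_order K)^-1%g (Ordinal lt_km))) (c := c).
by rewrite permKV /= le -addnS lt; apply.
Qed.

Lemma bottom_step x : row x = bottom_row -> bound K n.+1 <= col x ->
    (col x).+1 < W ->
  exists y, [/\ row y = bottom_row, col y = (col x).+1 & adj x y].
Proof.
move=> rx le_x ltW.
have [|y ry cy] := @cell_exists W (free K) bottom_row (col x).+1 ltW.
  by apply: bottom_free; lia.
by exists y; rewrite adjacentE rx ry cy !eqxx.
Qed.

Lemma clauses_to_lit i j :
  exists2 q, shortest_path adj z0 (lit_target i j) q & forall x, x \in q ->
    bound K n.+1 <= col x /\ (row x = bottom_row \/ x = lit_target i j).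
Proof.
set t := lit_target i j.
have rt : row t = middle_row by apply: (cg_lit_row (clause_gadgets K i)).
have le_t : bound K n.+1 <= col t by apply: target_col.
(* Descent along the bottom row and then up. The middle row has number 1, so [row x - 1] counts the
   vertical steps left. *)
pose S x := bound K n.+1 <= col x <= col t /\ (row x = bottom_row \/ x = t).
have [||||q sq qP] := @shortest_descent _ adj
    (fun x => (col t - col x) + (row x - 1)) S t _ _ _ z0.
- by move=> x y; rewrite adjacentE; lia.
- by rewrite rt subnn.
- move=> x [x_cols [rx|//]] _; have [lt|ge] := ltnP (col x) (col t).
    have [||y [ry cy exy]] := bottom_step rx; first by lia.
      by apply: leq_trans (col_ltW t).
    exists y; rewrite rx ry cy; split=> //; last by lia.
    by split; [lia | left].
  exists t; rewrite adjacentE rx rt /=; split; [|lia|lia].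
  by split; [lia | right].
- by split; [rewrite col_z0; lia | left].
by exists q => // x /qP[x_cols rx]; split=> //; lia.
Qed.

(** The position [j] is free, so the agent can later be sent through the target of a true literal.
    Confining the top-row part to the gadget of [i] rules out targets of other clause agents. *)
Lemma clauses_to_clause i j :
  exists2 q, shortest_path adj z0 (clause_target i) q & forall x, x \in q ->
    bound K n.+1 <= col x /\
    [\/ row x = bottom_row, x = lit_target i j
      | row x = top_row /\ bound K (n.+1 + clause_order K i) <= col x
          < bound K (n.+1 + clause_order K i).+1].
Proof.
set t := lit_target i j; set tc := clause_target i.
have ok := clause_gadgets K i.
have rt : row t = middle_row by apply: (cg_lit_row ok).
have rtc : row tc = top_row by apply: (cg_clause_row ok).
have le_t : bound K n.+1 <= col t by apply: target_col.
have t_tc := lit_target_col i j; have tc_in := clause_target_col i.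
rewrite -/t -/tc in t_tc tc_in.
pose S x := [\/ row x = bottom_row /\ bound K n.+1 <= col x <= col t, x = t
  | row x = top_row /\ col t <= col x <= col tc].
have top c : col t <= c <= col tc -> exists2 x : cellK, row x = top_row & col x = c.
  move=> c_in; apply: cell_exists; first by have := col_ltW tc; lia.
  by apply: (cg_top ok (j := j)); rewrite -/t; lia.
have [||||q sq qP] := @shortest_descent _ adj
    (fun x => (col tc - col x) + row x) S tc _ _ _ z0.
- by move=> x y; rewrite adjacentE; lia.
- by rewrite rtc subnn.
- move=> x [[rx x_cols]|->|[rx x_cols]] Nx.
  + have [lt|ge] := ltnP (col x) (col t).
      have [||y [ry cy exy]] := bottom_step rx; first by lia.
        by apply: leq_trans (col_ltW t).
      exists y; rewrite rx ry cy; split=> //; last by lia.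
      by constructor 1; split=> //; lia.
    exists t; rewrite adjacentE rx rt /=; split; [|lia|lia].
    by constructor 2.
  + have [|y ry cy] := top (col t); first lia.
    exists y; rewrite adjacentE rt ry cy /=; split; [|lia|lia].
    by constructor 3; split=> //; lia.
  + have [lt|ge] := ltnP (col x) (col tc); last first.
      by case: Nx; apply: cell_eq; [congruence | lia].
    have [|y ry cy] := top (col x).+1; first lia.
    exists y; rewrite adjacentE rx ry cy /=; split; [|lia|lia].
    by constructor 3; split=> //; lia.
- by constructor 1; rewrite col_z0; split=> //; lia.
exists q => // x /qP[[rx x_cols]|->|[rx x_cols]].
- by split; [lia | constructor 1].
- by split=> //; constructor 2.
by split; [lia | constructor 3; split=> //; lia].
Qed.

Lemma target_row r : row (target_cell K r) <> bottom_row.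
Proof.
case: r => [[i j]|i]; first by rewrite (cg_lit_row (clause_gadgets K i) j).
by rewrite (cg_clause_row (clause_gadgets K i)).
Qed.

(** * Complete routes and the schedule *)

(** Every walk from a start to a target visits [z0], so gluing there is optimal. Columns and the row
    of [z0] show that starts are met only on [q1] and targets only on [q2]; [meets] collects the
    latter. *)
Lemma route_cat r q1 q2 (meets : agent (instance_of K) -> Prop) :
    shortest_path adj (start_cell K r) z0 q1 ->
    (forall x, x \in start_cell K r :: q1 -> col x < bound K n.+1 \/ x = z0) ->
    shortest_path adj z0 (target_cell K r) q2 ->
    (forall x, x \in q2 -> bound K n.+1 <= col x /\
       forall r', x = target_cell K r' -> meets r') ->
  [/\ shortest_path adj (start_cell K r) (target_cell K r) (q1 ++ q2),
      forall r', start_cell K r' \in start_cell K r :: q1 ++ q2 -> r' <> r ->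
        start_cell K r' \in start_cell K r :: q1 /\
        dist adj (start_cell K r') z0 < dist adj (start_cell K r) z0
    & forall r', target_cell K r' \in start_cell K r :: q1 ++ q2 -> meets r'].
Proof.
move=> s1 cols1 s2 props2; split.
- apply: shortest_cat s1 s2 => s ws.
  have gate := gateP (k := n.+1); rewrite gate_bottom in gate.
  have k_in : 0 < n.+1 <= n + m by lia.
  have /andP[free_x _] : free K bottom_row (bound K n.+1).-1
      && free K bottom_row (bound K n.+1) by rewrite gate.
  have b_gt0 : 0 < bound K n.+1.
    by apply: leq_trans (bound_lt K (k := n) (leq_addr _ _)).
  have [|x rx cx] := @cell_exists W (free K) bottom_row (bound K n.+1).-1 _ free_x.
    by have := bound_le (k := n.+1) (k' := (n + m).+1) ltac:(lia); lia.
  have [|_ //] := walk_through_gate (gate k_in) _ rx col_z0 row_z0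
    (start_col r) (target_col r) ws.
  by rewrite cx prednK.
- move=> r'; rewrite -cat_cons mem_cat => /orP[x1 neq|/props2[le _]]; last first.
    by have := start_col r'; lia.
  split=> //; move: x1; rewrite inE => /predU1P[/start_inj//|].
  exact: dist_decreasing.
move=> r'; rewrite -cat_cons mem_cat => /orP[/cols1[lt|eq_z0]|/props2[_]].
- by have := target_col r'; lia.
- by case: (@target_row r'); rewrite eq_z0.
by apply.
Qed.

Definition stage (r : agent (instance_of K)) : nat :=
  match r with
  | inl (i, j) => if a (lit_at phi i j).1 == (lit_at phi i j).2 then 2 else 0
  | inr _ => 1
  end.

Lemma stage_kept r : 1 < stage r -> kept (start_cell K r).
Proof.
case: r => [[i j]|//] /=; case: eqP => // eq_a _.
by exists (lit_at phi i j).1; rewrite eq_a; apply: lit_start_side.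
Qed.

Hypothesis satisfied : forall i, exists j, a (lit_at phi i j).1 = (lit_at phi i j).2.

(** Provides what [sequential_plan] needs when agents are ordered by stage and then by distance to
    [z0]. *)
Lemma route r : exists p,
  [/\ shortest_path adj (start_cell K r) (target_cell K r) p,
      forall r', start_cell K r' \in start_cell K r :: p -> r' <> r ->
        stage r' <= stage r /\
        dist adj (start_cell K r') z0 < dist adj (start_cell K r) z0
    & forall r', target_cell K r' \in start_cell K r :: p -> r' <> r ->
        stage r < stage r'].
Proof.
case: r => [[i j]|i].
  have [q1 s1 q1P] := lit_to_clauses (lit_start_side i j).
  have [q2 s2 q2P] := clauses_to_lit i j.
  have [||sp starts targets] :=
      @route_cat (inl (i, j)) q1 q2 (fun r' => r' = inl (i, j)) s1 _ s2.
  - by move=> x /q1P[].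
  - move=> x /q2P[le x_in]; split=> // r' eq_x; rewrite eq_x in x_in.
    by case: x_in => [/target_row|/target_inj].
  exists (q1 ++ q2); split=> // [r' /starts h /h [] /q1P[ge _ Nkept] lt|r' /targets //].
  split=> //=; case: eqP => [_|neq]; first by case: (r') => [[? ?]|?] //=; case: ifP.
  (* A false literal stays right of the room, so it meets no clause start, and it avoids kept cells,
     so it meets no start of a true literal. *)
  case: r' ge Nkept {h lt} => [[i' j']|i'] ge Nkept; last first.
    by have := room_starts K i'; lia.
  rewrite leqNgt; apply/negP => pos; case: Nkept; last apply: stage_kept.
    by case: (a _) (_.2) neq => [] [].
  by move: pos; rewrite /=; case: ifP.
have [j sat_j] := satisfied i.
have [q1 s1 q1P] := clause_to_clauses i.
have [q2 s2 q2P] := clauses_to_clause i j.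
have [||sp starts targets] :=
    @route_cat (inr i) q1 q2 (fun r' => r' = inr i \/ r' = inl (i, j)) s1 _ s2.
- by move=> x /q1P[].
- move=> x /q2P[le x_in]; split=> // r' eq_x; rewrite eq_x in x_in.
  (* The bottom row holds no target, and in the top row of this gadget only the clause agent's own
     target can occur. *)
  case: x_in => [/target_row //|/target_inj|]; first by right.
  case: r' {eq_x} => [[i' j']|i'] [r_top c_in].
    by move: r_top; rewrite (cg_lit_row (clause_gadgets K i') j').
  left; have c_in' := clause_target_col i'; congr inr.
  have := clause_section i; have := clause_section i' => le_i' le_i.
  have := section_unique _ _ c_in c_in' => /(_ ltac:(lia) ltac:(lia)).
  by move/addnI/val_inj/perm_inj.
exists (q1 ++ q2); split=> // [r' /starts h /h [] /q1P[_ Nkept] lt|r' /targets[]//].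
  by split=> //; rewrite leqNgt; apply/negP=> /stage_kept.
by move=> -> _ /=; rewrite sat_j eqxx.
Qed.

Lemma satisfiable_plan_at : exists plan : agent (instance_of K) -> nat -> cellK,
  [/\ motion_plan (M := instance_of K) plan, collision_free plan, monotone plan
    & distance_cost plan (dstar (instance_of K))].
Proof.
have [p pP] := fin_all_exists route.
(* Lexicographic order: the factor exceeds every value of [dist], which is at most the number of
   cells. *)
pose key r := stage r * #|{: cellK}|.+1 + dist adj (start_cell K r) z0.
apply: (sequential_plan (M := instance_of K) (key := key) (p := p)) => [r|].
  by have [] := pP r.
move=> r r' neq; have [_ starts _] := pP r; have [_ _ targets] := pP r'.
have dist_le u : dist adj u z0 <= #|{: cellK}|.
  by rewrite -[X in _ <= X](size_iota 0) find_size.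
rewrite /key => le_key; split; apply/negP.
  by case/starts=> [/esym//|le_st lt_d]; nia.
by move/targets=> /(_ neq) lt_st; have := dist_le (start_cell K r'); nia.
Qed.
End Schedule.

Lemma satisfiable_plan : satisfiable phi ->
  exists plan : agent (instance_of K) -> nat -> cellK,
  [/\ motion_plan (M := instance_of K) plan, collision_free plan, monotone plan
    & distance_cost plan (dstar (instance_of K))].
Proof.
case=> a sat; have [m0|m_gt0] := posnP m.
  (* Without clauses column [bound K n.+1] is outside the grid and [z0] does not exist, but there
     are no agents either. *)
  have no_agent (r : agent (instance_of K)) : False.
    by case: r => [[[i]]|[i]]; rewrite m0.
  by apply: (sequential_plan (M := instance_of K) (key := fun=> 0)
    (p := fun=> [::])) => r; case: (no_agent r).
have [|z0 rz cz] := @gate_cell n.+1; first lia.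
rewrite (gate_bottom m_gt0) in rz.
exact: (satisfiable_plan_at m_gt0 rz cz sat).
Qed.
End Instance.

Theorem theorem1 (n m : nat) (phi : formula3 n m) (K : construction phi) :
  let M := instance_of K in
  (exists plan : agent M -> nat -> vertex M,
     [/\ motion_plan plan, collision_free plan, monotone plan
       & distance_cost plan (dstar M)])
  <-> satisfiable phi.
Proof.
split=> [[plan [mp cf mono cost]]|]; first exact: plan_satisfiable cost.
exact: satisfiable_plan.
Qed.
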